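(* The following statements are equivalent: (i) $\mathcal{K}\cap(\{0_Y\}\times\mathbb{R})=\mathcal{M}\cap(\{0_Y\}\times\mathbb{R})$; (ii) $\inf\{\langle x,c\rangle: Ax-b\in Q,\ x\in P\}=\max\{\langle b,w\rangle:-A^*w+c\in P^*,\ w\in Q^*\}$, where writing $\max$ means that the supremum is attained at some feasible $w$.
   Context: Setting: $(X,Y)$ and $(Z,W)$ are separated dual pairs of real vector spaces, i.e. there are bilinear forms on $X\times Y$ and on $Z\times W$, both denoted $\langle\cdot,\cdot\rangle$, such that $\langle x_0,y\rangle=0$ for all $y\in Y$ implies $x_0=0$, and $\langle x,y_0\rangle=0$ for all $x\in X$ implies $y_0=0$ (and likewise for $(Z,W)$). No topology is assumed. $A:X\to Z$ is a linear map with adjoint $A^*:W\to Y$, a linear map satisfying $\langle x,A^*w\rangle=\langle Ax,w\rangle$ for all $x\in X$, $w\in W$ (assumed to exist). $P\subset X$ and $Q\subset Z$ are convex cones (nonempty, and $\alpha u+\beta v$ is in the cone for all $\alpha,\beta\ge 0$ and $u,v$ in the cone); $b\in Z$, $c\in Y$. Dual cones: $P^*=\{y\in Y:\langle x,y\rangle\ge 0\ \forall x\in P\}$, $Q^*=\{w\in W:\langle q,w\rangle\ge 0\ \forall q\in Q\}$. Feasible sets: $F(\mathcal{P})=\{x\in P: Ax-b\in Q\}$ and $F(\mathcal{D})=\{w\in Q^*:-A^*w+c\in P^*\}$; both are assumed nonempty. Definitions: $\mathcal{K}=\bigcup_{w\in Q^*}\big((-A^*w+c-P^* )\times\,]-\infty,\langle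 b,w\rangle]\big)\subset Y\times\mathbb{R}$; $v_{\mathcal{P}}(y)=\inf\{\langle x,c-y\rangle:x\in F(\mathcal{P})\}$ for $y\in Y$ (possibly $-\infty$); $\mathcal{M}=\mathrm{hypo}\,v_{\mathcal{P}}=\{(y,r)\in Y\times\mathbb{R}: r\le v_{\mathcal{P}}(y)\}$. $0_Y$ is the zero vector of $Y$. *)

(* Defs.v *)
From HB Require Import structures.
From mathcomp Require Import all_boot all_order all_algebra.
From mathcomp Require Import boolp classical_sets reals ereal constructive_ereal.

Set Implicit Arguments.
Unset Strict Implicit.
Unset Printing Implicit Defensive.

Import Order.TTheory GRing.Theory Num.Theory.

Local Open Scope classical_set_scope.
Local Open Scope ring_scope.

Definition separated_pair (R : realType) (X Y : lmodType R)
    (f : {bilinear X -> Y -> R | *%R & *%R}) : Prop :=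
  (forall x0 : X, (forall y : Y, f x0 y = 0) -> x0 = 0) /\
  (forall y0 : Y, (forall x : X, f x y0 = 0) -> y0 = 0).

Definition convex_cone (R : realType) (X : lmodType R) (C : set X) : Prop :=
  C !=set0 /\
  forall (a b : R) (u v : X), 0 <= a -> 0 <= b -> C u -> C v ->
    C (a *: u + b *: v).

Definition dual_cone (R : realType) (X Y : lmodType R)
    (f : {bilinear X -> Y -> R | *%R & *%R}) (C : set X) : set Y :=
  [set y | forall x, C x -> 0 <= f x y].

Definition primal_feasible (R : realType) (X Z : lmodType R)
    (A : {linear X -> Z}) (P : set X) (Q : set Z) (b : Z) : set X :=
  [set x | P x /\ Q (A x - b)].

Definition dual_feasible (R : realType) (X Y Z W : lmodType R)
    (fXY : {bilinear X -> Y -> R | *%R & *%R})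
    (fZW : {bilinear Z -> W -> R | *%R & *%R})
    (Astar : {linear W -> Y}) (P : set X) (Q : set Z) (c : Y) : set W :=
  [set w | dual_cone fZW Q w /\ dual_cone fXY P (- Astar w + c)].

Definition setK (R : realType) (X Y Z W : lmodType R)
    (fXY : {bilinear X -> Y -> R | *%R & *%R})
    (fZW : {bilinear Z -> W -> R | *%R & *%R})
    (Astar : {linear W -> Y}) (P : set X) (Q : set Z) (b : Z) (c : Y) :
    set (Y * R) :=
  \bigcup_(w in dual_cone fZW Q)
    ([set - Astar w + c - p | p in dual_cone fXY P] `*`
     [set r : R | r <= fZW b w]).

Definition primal_value (R : realType) (X Y Z : lmodType R)
    (fXY : {bilinear X -> Y -> R | *%R & *%R})
    (A : {linear X -> Z}) (P : set X) (Q : set Z) (b : Z) (c : Y) (y : Y) :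
    \bar R :=
  ereal_inf [set (fXY x (c - y))%:E | x in primal_feasible A P Q b].

Definition hypo (R : realType) (Y : Type) (v : Y -> \bar R) : set (Y * R) :=
  [set p | (p.2%:E <= v p.1)%E].

(* Main.v *)
Require Import Defs.
From HB Require Import structures.
From mathcomp Require Import all_boot all_order all_algebra.
From mathcomp Require Import boolp classical_sets reals ereal constructive_ereal.

Set Implicit Arguments.
Unset Strict Implicit.
Unset Printing Implicit Defensive.

Import Order.TTheory GRing.Theory Num.Theory.

Local Open Scope classical_set_scope.
Local Open Scope ring_scope.

(** K and the hypograph are compared only over the zero vector, where they are
    easy to describe: [(0, r)] lies in K iff [r <= <b, w>] for some dual
    feasible [w] ([setK_at0]), and [(0, r)] lies in the hypograph iff [r] is at
    most the primal value.  Hence the first slice is the set of real lower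
    bounds of dual objective values, the second is the half-line below the
    primal value.

    Weak duality ([weak_duality_ereal]) always gives that the first slice is
    contained in the second.  The reverse inclusion is a statement about
    attainment.  Since both problems are feasible, the primal value is a real
    number [v] ([primal_value_fin_num]), so [(0, v)] itself lies in the
    hypograph; if it also lies in K, it yields a dual feasible [w] with
    [v <= <b, w>], and weak duality forces [w] to be optimal with zero gap.
    Conversely, a dual optimal [w] with zero gap witnesses membership in K for
    every [r] below the primal value. *)

Section Duality.
Context (R : realType) (X Y Z W : lmodType R).
Context (fXY : {bilinear X -> Y -> R | *%R & *%R}).
Context (fZW : {bilinear Z -> W -> R | *%R & *%R}).
Context (A : {linear X -> Z}) (Astar : {linear W -> Y}).
Context (P : set X) (Q : set Z) (b : Z) (c : Y).

Local Notation primal := (primal_feasible A P Q b).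
Local Notation dual := (dual_feasible fXY fZW Astar P Q c).
Local Notation primal_inf := (ereal_inf [set (fXY x c)%:E | x in primal]).
Local Notation dual_sup := (ereal_sup [set (fZW b w)%:E | w in dual]).

(** The vector [p] in [- A* w + c - p = 0] can only be [- A* w + c], so that
    over zero the membership of [p] in the dual cone of [P] becomes the dual
    constraint on [w]. *)
Lemma setK_at0 (r : R) :
  setK fXY fZW Astar P Q b c (0, r) <-> exists2 w, dual w & r <= fZW b w.
Proof.
split=> [[w Qw [[p Pp /= /subr0_eq pE] rw]]|[w [Qw Pw] rw]].
  by exists w => //; split=> //; rewrite pE.
by exists w => //; split=> //=; exists (- Astar w + c); rewrite ?subrr.
Qed.

Lemma hypo_primal_value_at0 (r : R) :
  hypo (primal_value fXY A P Q b c) (0, r) <-> (r%:E <= primal_inf)%E.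
Proof. by rewrite /hypo /primal_value /= subr0. Qed.

Context (adjA : forall x w, fXY x (Astar w) = fZW (A x) w).

(** The gap is a sum of two terms that feasibility makes nonnegative:
    [<x, c> - <b, w> = <x, - A* w + c> + <A x - b, w>]. *)
Lemma weak_duality (x : X) (w : W) :
  primal x -> dual w -> fZW b w <= fXY x c.
Proof.
move=> [Px Qx] [Qw Pw]; rewrite -subr_ge0.
suff -> : fXY x c - fZW b w = fXY x (- Astar w + c) + fZW (A x - b) w.
  by rewrite addr_ge0 ?Pw ?Qw.
by rewrite linearDr linearNr linearBl /= adjA [- _ + _]addrC addrA subrK.
Qed.

Lemma weak_duality_ereal (w : W) : dual w -> ((fZW b w)%:E <= primal_inf)%E.
Proof.
by move=> dw; apply: le_ereal_inf_tmp => _ [x px <-]; rewrite lee_fin weak_duality.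
Qed.

Lemma dual_sup_le_primal_inf : (dual_sup <= primal_inf)%E.
Proof. by apply: ge_ereal_sup => _ [w dw <-]; exact: weak_duality_ereal. Qed.

Lemma primal_value_fin_num :
  primal !=set0 -> dual !=set0 -> primal_inf \is a fin_num.
Proof.
move=> [x px] [w dw]; rewrite fin_real //; apply/andP; split.
  exact: lt_le_trans (ltNyr _) (weak_duality_ereal dw).
by apply: le_lt_trans (ltry (fXY x c)); apply: ereal_inf_lbound; exists x.
Qed.

(** A dual feasible point reaching the primal value closes the chain
    [primal_inf <= <b, w> <= dual_sup <= primal_inf]. *)
Lemma dual_optimal_of_ge (w : W) : dual w -> (primal_inf <= (fZW b w)%:E)%E ->
  primal_inf = dual_sup /\ (fZW b w)%:E = dual_sup.
Proof.
move=> dw vw.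
have ws : ((fZW b w)%:E <= dual_sup)%E by apply: ereal_sup_ubound; exists w.
have sv := dual_sup_le_primal_inf.
by split; apply/le_anti; rewrite ?sv ?ws ?(le_trans vw ws) ?(le_trans sv vw).
Qed.

End Duality.

Theorem theorem4p8 (R : realType) (X Y Z W : lmodType R)
    (fXY : {bilinear X -> Y -> R | *%R & *%R})
    (fZW : {bilinear Z -> W -> R | *%R & *%R})
    (sepXY : separated_pair fXY) (sepZW : separated_pair fZW)
    (A : {linear X -> Z}) (Astar : {linear W -> Y})
    (adjA : forall (x : X) (w : W), fXY x (Astar w) = fZW (A x) w)
    (P : set X) (Q : set Z) (coneP : convex_cone P) (coneQ : convex_cone Q)
    (b : Z) (c : Y)
    (feasP : primal_feasible A P Q b !=set0)
    (feasD : dual_feasible fXY fZW Astar P Q c !=set0) :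
  setK fXY fZW Astar P Q b c `&` ([set (0 : Y)] `*` [set: R]) =
  hypo (primal_value fXY A P Q b c) `&` ([set (0 : Y)] `*` [set: R])
  <->
  ereal_inf [set (fXY x c)%:E | x in primal_feasible A P Q b] =
  ereal_sup [set (fZW b w)%:E | w in dual_feasible fXY fZW Astar P Q c] /\
  exists2 w : W, dual_feasible fXY fZW Astar P Q c w &
    (fZW b w)%:E =
    ereal_sup [set (fZW b w')%:E | w' in dual_feasible fXY fZW Astar P Q c].
Proof.
split=> [KM|[v_eq [w dw w_opt]]].
  have v_fin := primal_value_fin_num adjA feasP feasD.
  set v := ereal_inf _ in v_fin *.
  have : (hypo (primal_value fXY A P Q b c) `&` ([set 0] `*` setT))
           (0, fine v).
    by split=> //; apply/hypo_primal_value_at0; rewrite fineK.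
  rewrite -{}KM => -[/setK_at0[w dw vw] _].
  rewrite -lee_fin fineK // in vw.
  have [v_eq w_opt] := dual_optimal_of_ge adjA dw vw.
  by split=> //; exists w.
apply/seteqP; split=> -[y r] [+ [/= y0 _]]; rewrite {y}y0.
  move=> /setK_at0[w' dw' rw']; split=> //; apply/hypo_primal_value_at0.
  by apply: le_trans (weak_duality_ereal b adjA dw'); rewrite lee_fin.
move=> /hypo_primal_value_at0 rv; split=> //; apply/setK_at0; exists w => //.
by rewrite -lee_fin w_opt -v_eq.
Qed.
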